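(* Let $m\in\mathbb N$, $a>0$, let $\mathbf r=(r_j)_{j=1}^\infty$ be a sequence of reals with $r_j>0$, and let $p=0$, $q\ge0$. Assume that $$M_{0,q}(m):=\sum_{j=1}^\infty\frac{1}{e^{mr_j/a}-1}<\infty .$$ Then for every $T\ge1$ $$|E(T)|\ \le\ \Big(\frac32\Big)^{2m}\exp[M_{0,q}(m)]\;T^{m/a}.$$
   Context: $\mathbb Z_+=\{0,1,2,\dots\}$; $\mathbb Z^\infty_{+*}$ is the set of sequences $\mathbf s=(s_j)_{j\ge1}$ of nonnegative integers with only finitely many nonzero entries. $|\cdot|$ denotes cardinality of a set. The hyperbolic cross is $$E(T):=\{(\mathbf k,\mathbf s)\in\mathbb Z^m_+\times\mathbb Z^\infty_{+*}:\rho(\mathbf k,\mathbf s)\le T\},$$ $$\rho(\mathbf k,\mathbf s):=\max_{1\le j\le m}(1+k_j)^a\prod_{j=1}^\infty(1+ps_j)^{-q}\exp\Big(\sum_{j=1}^\infty r_js_j\Big),$$ so that for $p=0$ the product $\prod_j(1+ps_j)^{-q}$ equals $1$. *)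

(* Defs.v *)
From mathcomp Require Import all_boot all_order all_algebra.
From mathcomp Require Import finmap.
From mathcomp Require Import all_classical all_reals all_analysis.
Set Implicit Arguments.
Unset Strict Implicit.
Unset Printing Implicit Defensive.
Import Order.TTheory GRing.Theory Num.Theory.
Local Open Scope classical_set_scope.
Local Open Scope ring_scope.

(* Sequences (s_j)_{j >= 1}, (r_j)_{j >= 1} are indexed from 0: [s j] and [r j]
   stand for s_{j+1} and r_{j+1}. *)

Definition fin_seq := {fsfun nat -> nat with 0%N}.

(* The product and the sum over all j reduce to the support of s, since the
   other factors are (1 + 0)^(-q) = 1 and the other terms are 0. The default
   value 0 of the maximum is inert for m > 0, because its entries are
   positive. *)
Definition rho (R : realType) (m : nat) (a p q : R) (r : nat -> R)
    (k : {ffun 'I_m -> nat}) (s : fin_seq) : R :=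
  \big[Num.max/0]_(j < m) ((1 + (k j)%:R) `^ a)
  * \prod_(j <- finsupp s) ((1 + p * (s j)%:R) `^ (- q))
  * expR (\sum_(j <- finsupp s) r j * (s j)%:R).

Definition hyperbolic_cross (R : realType) (m : nat) (a p q : R)
    (r : nat -> R) (T : R) : set ({ffun 'I_m -> nat} * fin_seq) :=
  [set ks | rho a p q r ks.1 ks.2 <= T].
Arguments hyperbolic_cross {R} m a p q r T.

(* M_{0,q}(m), which does not depend on q. *)
Definition M0 (R : realType) (m : nat) (a : R) (r : nat -> R) : \bar R :=
  (\sum_(0 <= j <oo) ((expR (m%:R * r j / a) - 1)^-1)%:E)%E.

(* Main.v *)
Require Import Defs.
From mathcomp Require Import all_boot all_order all_algebra.
From mathcomp Require Import finmap.
From mathcomp Require Import all_classical all_reals all_analysis.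
Set Implicit Arguments.
Unset Strict Implicit.
Unset Printing Implicit Defensive.
Import Order.TTheory GRing.Theory Num.Theory.
Local Open Scope classical_set_scope.
Local Open Scope ring_scope.

(** Fibre the hyperbolic cross over [s]. Writing [X := T * expR (- \sum_j r_j s_j)],
    a point [(k, s)] lies in it exactly when [1 + k_j <= X `^ a^-1] for every [j],
    so each fibre is the set of lattice points of a cube and has at most
    [X `^ (m / a) = T `^ (m / a) * \prod_j x_j ^+ s_j] points, where
    [x_j := expR (- (m r_j / a))]. Summing the weights [\prod_j x_j ^+ s_j] over
    all [s] gives a product of geometric series, and each factor satisfies
    [(1 - x_j)^-1 = 1 + (expR (m r_j / a) - 1)^-1
      <= expR ((expR (m r_j / a) - 1)^-1)],
    so that the product is at most [expR M0]. The resulting estimate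
    [expR M0 * T `^ (m / a)] gives the theorem because [(3 / 2) ^+ (2 * m) >= 1].

    The argument is run on an arbitrary finite subset of the cross
    ([card_hyperbolic_cross_fset]): this keeps every sum finite, and since the
    bound does not depend on the subset, the cross itself is finite. *)

Lemma uniq_size_le_card (A : eqType) (I : finType) (h : A -> I) (s : seq A) :
  {in s &, injective h} -> uniq s -> (size s <= #|I|)%N.
Proof.
move=> hinj us; rewrite -(size_map h s).
have u : uniq (map h s) by rewrite map_inj_in_uniq.
by rewrite -(card_uniqP u) max_card.
Qed.

(** If [m = 0] the bound is [1]; otherwise [k] injects into the cube of side
    [truncn L], which is empty when [L < 1]. *)
Lemma size_cube_le (R : realType) (m : nat) (L : R)
    (K : seq {ffun 'I_m -> nat}) :
  0 <= L -> uniq K -> (forall k, k \in K -> forall j, 1 + (k j)%:R <= L) ->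
  (size K)%:R <= L ^+ m.
Proof.
move=> L0 uK hK.
have klt k j : k \in K -> (k j < Num.truncn L)%N.
  by move=> kK; rewrite truncn_ge_nat// -natr1 addrC hK.
apply: (@le_trans _ _ ((Num.truncn L ^ m)%N%:R)); last first.
  by rewrite natrX lerXn2r ?nnegrE ?ler0n// truncn_le.
rewrite ler_nat; case: (Num.truncn L) klt => [|n] klt.
  case: m K uK klt {hK} => [|m] K uK klt.
    rewrite expn0 -[leqRHS]card_unit.
    by apply: (@uniq_size_le_card _ _ (fun=> tt)) => // k k' _ _ _;
      apply/ffunP => -[].
  by case: K uK klt => // k K _ /(_ k ord0 (mem_head _ _)).
rewrite -[n.+1 in leqRHS]card_ord -[m in leqRHS]card_ord -card_ffun.
apply: (@uniq_size_le_card _ _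
  (fun k : {ffun 'I_m -> nat} => [ffun j => inord (k j) : 'I_n.+1])) => //.
move=> k k' kK k'K /ffunP e; apply/ffunP => j.
by have /(congr1 val) := e j; rewrite !ffunE /= !inordK ?klt.
Qed.

Lemma geometric_sum_le (R : realFieldType) (x : R) (B : nat) :
  0 <= x -> x < 1 -> \sum_(i < B) x ^+ i <= (1 - x)^-1.
Proof.
move=> x0 x1; have x1' : 0 < 1 - x by rewrite subr_gt0.
rewrite -[leRHS]mul1r ler_pdivlMr// mulrC -[1 - x]opprB mulNr -subrX1 opprB.
by rewrite lerBlDr lerDl exprn_ge0.
Qed.

Lemma leq_bigmax_fset (I : choiceType) (A : {fset I}) (F : I -> nat) (i : I) :
  i \in A -> (F i <= \max_(i <- A) F i)%N.
Proof.
move=> iA; exact: (@leq_bigmax_seq I (enum_fset A) xpredT F i iA isT).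
Qed.

(** A finite set of sequences lies in a box [{0, ..., B}^N], over which the sum
    of the weights factors, by distributivity, into truncated geometric
    series. *)
Lemma sum_weight_le (R : realType) (x : nat -> R) (A : {fset fin_seq}) :
  (forall j, 0 <= x j) -> (forall j, x j < 1) ->
  exists N, \sum_(s <- A) \prod_(j <- finsupp s) x j ^+ s j
    <= \prod_(j < N) (1 - x j)^-1.
Proof.
move=> x0 x1.
pose N := (\max_(s <- A) \max_(j <- finsupp s) j.+1)%N.
pose B := (\max_(s <- A) \max_(j <- finsupp s) s j)%N.
have jN (s : fin_seq) j : s \in A -> j \in finsupp s -> (j < N)%N.
  move=> sA js; apply: (@leq_trans (\max_(j <- finsupp s) j.+1)%N); last first.
    exact: (@leq_bigmax_fset _ A
      (fun s : fin_seq => \max_(j <- finsupp s) j.+1)%N).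
  exact: (leq_bigmax_fset (fun j => j.+1)).
have sB (s : fin_seq) j : s \in A -> (s j < B.+1)%N.
  move=> sA; have [js|] := boolP (j \in finsupp s); last first.
    by rewrite memNfinsupp => /eqP ->.
  rewrite ltnS; apply: (@leq_trans (\max_(j <- finsupp s) s j)%N); last first.
    exact: (@leq_bigmax_fset _ A
      (fun s : fin_seq => \max_(j <- finsupp s) s j)%N).
  exact: leq_bigmax_fset.
pose enc (s : fin_seq) := [ffun j : 'I_N => inord (s j) : 'I_B.+1].
have enc_inj : {in A &, injective enc}.
  move=> s s' sA s'A /ffunP e; apply/fsfunP => j.
  have [jltN|Nj] := ltnP j N.
    have /(congr1 val) := e (Ordinal jltN).
    by rewrite !ffunE /= !inordK ?sB.
  have out (u : fin_seq) : u \in A -> u j = 0%N.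
    move=> uA; apply/eqP; rewrite -memNfinsupp.
    by apply: contraL Nj => ju; rewrite -ltnNge (jN u).
  by rewrite !out.
exists N; apply: (@le_trans _ _ (\prod_(j < N) \sum_(i < B.+1) x j ^+ i)).
  rewrite bigA_distr_bigA /=.
  have -> : \sum_(s <- A) \prod_(j <- finsupp s) x j ^+ s j
      = \sum_(f <- [seq enc s | s <- A]) \prod_(j < N) x j ^+ f j.
    rewrite big_map; apply: eq_big_seq => s sA.
    rewrite (eq_bigr (fun j : 'I_N => x j ^+ s j)); last first.
      by move=> j _; rewrite ffunE inordK ?sB.
    rewrite -(big_mkord xpredT (fun j => x j ^+ s j)).
    rewrite [RHS](bigID [pred j | j \in finsupp s]) /= [X in _ * X]big1 ?mulr1.
      rewrite -[RHS]big_filter; apply/perm_big/uniq_perm; first exact: fset_uniq.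
      - exact/filter_uniq/iota_uniq.
      - move=> j; rewrite mem_filter mem_index_iota /=.
        by have [js|//] := boolP (j \in finsupp s); rewrite (jN s).
    by move=> j; rewrite memNfinsupp => /eqP ->; rewrite expr0.
  rewrite big_uniq ?map_inj_in_uniq ?fset_uniq//=.
  rewrite [leRHS](bigID [pred f | f \in [seq enc s | s <- A]]) /= lerDl.
  by apply: sumr_ge0 => f _; apply: prodr_ge0 => j _; rewrite exprn_ge0.
apply: ler_prod => j _; rewrite geometric_sum_le// andbT.
by apply: sumr_ge0 => i _; rewrite exprn_ge0.
Qed.

(** With [x = expR (- y)], the geometric series is
    [(1 - x)^-1 = 1 + (expR y - 1)^-1]. *)
Lemma inv_1B_expRN_le (R : realType) (y : R) : 0 < y ->
  (1 - expR (- y))^-1 <= expR ((expR y - 1)^-1).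
Proof.
move=> y0; apply: le_trans (expR_ge1Dx _).
have e1 : expR y - 1 != 0 by rewrite gt_eqF// subr_gt0 expR_gt1.
have e0 : expR y != 0 by rewrite gt_eqF// expR_gt0.
have -> : 1 - expR (- y) = (expR y - 1) / expR y.
  by rewrite expRN mulrBl mulfV// mul1r.
by rewrite invf_div -[X in X / _](subrK 1) mulrDl mulfV// mul1r.
Qed.

Lemma prod_le_expR_M0 (R : realType) (m : nat) (a : R) (r : nat -> R) (N : nat) :
  (0 < m)%N -> 0 < a -> (forall j, 0 < r j) -> (M0 m a r < +oo)%E ->
  \prod_(j < N) (1 - expR (- (m%:R * r j / a)))^-1 <= expR (fine (M0 m a r)).
Proof.
move=> m0 a0 r0 hM.
have y0 j : 0 < m%:R * r j / a by rewrite divr_gt0 ?mulr_gt0 ?ltr0n.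
have t0 j : 0 <= (expR (m%:R * r j / a) - 1)^-1.
  by rewrite invr_ge0 subr_ge0 ltW// expR_gt1.
apply: (@le_trans _ _
  (expR (\sum_(j < N) (expR (m%:R * r j / a) - 1)^-1))).
  rewrite expR_sum; apply: ler_prod => j _; rewrite inv_1B_expRN_le// andbT.
  by rewrite invr_ge0 subr_ge0 ltW// expR_lt1 oppr_lt0.
have M0_ge0 : (0 <= M0 m a r)%E.
  by apply: nneseries_ge0 => j _ _; rewrite lee_fin t0.
rewrite ler_expR -lee_fin fineK ?ge0_fin_numE//.
rewrite -(big_mkord xpredT (fun j => (expR (m%:R * r j / a) - 1)^-1)).
rewrite -sumEFin.
by apply: nneseries_lim_ge => j _ _; rewrite lee_fin t0.
Qed.

(** At [p = 0] the product in [rho] is [1], so membership says that [k] lies in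
    a cube whose side depends on [s]. *)
Lemma hyperbolic_cross_side (R : realType) (m : nat) (a q : R) (r : nat -> R)
    (T : R) (k : {ffun 'I_m -> nat}) (s : fin_seq) :
  0 < a -> hyperbolic_cross m a 0 q r T (k, s) ->
  forall j, 1 + (k j)%:R
    <= (T * expR (- \sum_(i <- finsupp s) r i * (s i)%:R)) `^ a^-1.
Proof.
move=> a0; rewrite /hyperbolic_cross /= /rho => h j.
move: h; rewrite big1 ?mulr1; last by move=> i _; rewrite mul0r addr0 powR1.
rewrite -ler_pdivlMr ?expR_gt0// -expRN => h.
have h1 : (1 + (k j)%:R) `^ a
    <= T * expR (- \sum_(i <- finsupp s) r i * (s i)%:R).
  by apply: le_trans h; apply: (le_bigmax_cond _ (fun j => (1 + (k j)%:R) `^ a)).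
have -> : 1 + (k j)%:R = ((1 + (k j)%:R) `^ a) `^ a^-1 :> R.
  by rewrite -powRrM mulfV ?gt_eqF// powRr1// addr_ge0.
apply: ge0_ler_powR (h1); rewrite ?nnegrE ?powR_ge0 ?invr_ge0 ?(ltW a0)//.
exact: le_trans (powR_ge0 _ _) h1.
Qed.

Lemma side_expr (R : realType) (m : nat) (a : R) (r : nat -> R) (T : R)
    (s : fin_seq) : 0 <= T ->
  ((T * expR (- \sum_(i <- finsupp s) r i * (s i)%:R)) `^ a^-1) ^+ m
  = T `^ (m%:R / a)
    * \prod_(i <- finsupp s) expR (- (m%:R * r i / a)) ^+ s i.
Proof.
move=> T0; rewrite -powR_mulrn ?powR_ge0// -powRrM [a^-1 * _]mulrC.
rewrite powRM ?expR_ge0//; congr (_ * _).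
rewrite -expRM -sumrN mulr_suml expR_sum; apply: eq_bigr => i _.
rewrite -expRM_natr; congr expR.
by rewrite !mulNr mulrAC mulrA [r i * _]mulrC.
Qed.

(** The points of [F] are counted fibre by fibre: the fibre over [s] lies in a
    cube, and the cube volumes are the weights summed by [sum_weight_le]. *)
Lemma card_hyperbolic_cross_fset (R : realType) (m : nat) (a q : R)
    (r : nat -> R) (T : R) (F : {fset {ffun 'I_m -> nat} * fin_seq}) :
  (0 < m)%N -> 0 < a -> (forall j, 0 < r j) -> (M0 m a r < +oo)%E -> 0 <= T ->
  [set` F] `<=` hyperbolic_cross m a 0 q r T ->
  (#|` F|)%:R <= expR (fine (M0 m a r)) * T `^ (m%:R / a).
Proof.
move=> m0 a0 r0 hM T0 FE.
pose x j := expR (- (m%:R * r j / a)).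
have -> : (#|` F|)%:R = \sum_(u <- F) 1 :> R.
  by rewrite -(natr_sum _ _ _ (fun=> 1%N)) sum1_size.
rewrite (partition_big_imfset _ (fun u => u.2)) /=.
have fibre s : \sum_(u <- F | u.2 == s) 1
    <= T `^ (m%:R / a) * \prod_(i <- finsupp s) x i ^+ s i.
  rewrite -(@side_expr _ m a r T s)//.
  rewrite -big_filter -(natr_sum _ _ _ (fun=> 1%N)) sum1_size.
  rewrite -(size_map fst); apply: size_cube_le; first exact: powR_ge0.
    rewrite map_inj_in_uniq ?filter_uniq ?fset_uniq// => -[k s1] [k' s2].
    by rewrite !mem_filter /= => /andP[/eqP-> _] /andP[/eqP-> _] ->.
  move=> k /mapP[[k' s'] +] ->; rewrite mem_filter /= => /andP[/eqP-> uF].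
  exact/hyperbolic_cross_side/FE.
apply: le_trans (ler_sum _ (fun s _ => fibre s)) _.
rewrite -mulr_sumr mulrC ler_wpM2r ?powR_ge0//.
have [j|j|N hN] := @sum_weight_le R x [fset u.2 | u in F]%fset.
- exact: expR_ge0.
- by rewrite expR_lt1 oppr_lt0 divr_gt0 ?mulr_gt0 ?ltr0n.
exact/(le_trans hN)/prod_le_expR_M0.
Qed.

Theorem theorem2p7 (R : realType) (m : nat) (a q : R) (r : nat -> R)
    (hm : (0 < m)%N) (ha : 0 < a) (hr : forall j, 0 < r j) (hq : 0 <= q)
    (hM : (M0 m a r < +oo)%E) (T : R) (hT : 1 <= T) :
  finite_set (hyperbolic_cross m a 0 q r T) /\
  (#|` fset_set (hyperbolic_cross m a 0 q r T)|)%:R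
    <= (3 / 2) ^+ (2 * m) * expR (fine (M0 m a r)) * T `^ (m%:R / a).
Proof.
have T0 : 0 <= T by apply: le_trans hT.
pose C := expR (fine (M0 m a r)) * T `^ (m%:R / a).
have C0 : 0 <= C by rewrite mulr_ge0 ?expR_ge0 ?powR_ge0.
have bound F : [set` F] `<=` hyperbolic_cross m a 0 q r T -> (#|` F|)%:R <= C.
  exact: card_hyperbolic_cross_fset.
have fin : finite_set (hyperbolic_cross m a 0 q r T).
  (* An infinite set has finite subsets with more than C elements. *)
  apply: contrapT => /(@infinite_set_fset _ _ (Num.truncn C).+1)[F /bound FC].
  by rewrite ltnNge truncn_ge_nat ?FC.
split=> //; rewrite -mulrA -/C.
apply: (@le_trans _ _ C); first by apply: bound; rewrite fset_setK.
rewrite -[leLHS]mul1r ler_wpM2r// exprn_ege1//.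
by rewrite ler_pdivlMr// mul1r ler_nat.
Qed.
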